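(* Let $t\ge 2$ be an integer, and let $H$ be a hypergraph such that $\alpha(H)\le 2$. If $H$ does not contain $K_t$ as a minor, then $\chi(H)\le\left\lceil\frac{3}{2}(t-1)\right\rceil$.
   Context: A hypergraph is a pair $H=(V,E)$ with $V=V(H)$ a finite set and $E=E(H)$ a set of subsets of $V$ (hyperedges), each of size at least $2$. Graphs are the hypergraphs all of whose hyperedges have size exactly $2$; $K_t$ is the complete graph on $t$ vertices. Subhypergraph: $H_1\subseteq H_2$ if $V(H_1)\subseteq V(H_2)$ and $E(H_1)\subseteq E(H_2)$. Contraction: for $e\in E(H)$ and a new vertex $v\notin V(H)$, let $\phi:V(H)\to (V(H)\setminus e)\cup\{v\}$ be the identity on $V(H)\setminus e$ and constantly $v$ on $e$. Then $H/e$ has vertex-set $(V(H)\setminus e)\cup\{v\}$ and hyperedge-set $\{\phi(f)\mid f\in E(H),\ f\not\subseteq e\}$. Minor: $H_2$ is a minor of $H_1$ if a hypergraph isomorphic to $H_2$ can be obtained from $H_1$ by a finite sequence of operations, each being either moving to a subhypergraph or contracting a hyperedge. Coloring: a set of vertices is independent in $H$ if it contains no hyperedge as a subset; $\alpha(H)$ is the maximum size of an independent set. A proper coloring of $H$ is a map $c:V(H)\to S$ all of whose color classes are independent; $\chi(H)$ is the minimum size of a color set $S$ admitting a proper coloring. *)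

(* Defs.v *)
From HB Require Import structures.
From mathcomp Require Import all_boot all_order all_algebra.

Set Implicit Arguments.
Unset Strict Implicit.
Unset Printing Implicit Defensive.

(* The vertex set is a subset of an ambient finite type [T], so that passing to
   a subhypergraph stays within the same type. *)
Record hypergraph (T : finType) := Hypergraph {
  verts : {set T};
  hedges : {set {set T}};
  hedgesP : [forall e in hedges, (e \subset verts) && (2 <= #|e|)]
}.

Lemma hedge_sub (T : finType) (H : hypergraph T) (e : {set T}) :
  e \in hedges H -> e \subset verts H.
Proof. by have /forall_inP h := hedgesP H => /h /andP[]. Qed.

Lemma hedge_card (T : finType) (H : hypergraph T) (e : {set T}) :
  e \in hedges H -> 2 <= #|e|.
Proof. by have /forall_inP h := hedgesP H => /h /andP[]. Qed.

Lemma complete_graph_hedgesP (t : nat) :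
  [forall e in [set e : {set 'I_t} | #|e| == 2],
     (e \subset [set: 'I_t]) && (2 <= #|e|)].
Proof. by apply/forall_inP => e; rewrite inE subsetT => /eqP ->. Qed.

Definition complete_graph (t : nat) : hypergraph 'I_t :=
  Hypergraph (complete_graph_hedgesP t).

Definition subhypergraph (T : finType) (H1 H2 : hypergraph T) : bool :=
  (verts H1 \subset verts H2) && (hedges H1 \subset hedges H2).

Definition isomorphic (T U : finType) (H : hypergraph T) (G : hypergraph U) :
    Prop :=
  exists f : {x : T | x \in verts H} -> {y : U | y \in verts G},
    bijective f /\
    forall A : {set {x : T | x \in verts H}},
      (val @: A \in hedges H) = (val @: (f @: A) \in hedges G).

(* The contracted hypergraph lives on [option T]: [None] is the new vertex and
   an old vertex [x] is identified with [Some x]. *)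
Definition contract_map (T : finType) (e : {set T}) (x : T) : option T :=
  if x \in e then None else Some x.

Definition contract_verts (T : finType) (H : hypergraph T) (e : {set T}) :
    {set option T} :=
  None |: [set Some x | x in verts H :\: e].

Definition contract_hedges (T : finType) (H : hypergraph T) (e : {set T}) :
    {set {set option T}} :=
  [set contract_map e @: f | f : {set T} in hedges H & ~~ (f \subset e)].

Lemma contract_hedgesP (T : finType) (H : hypergraph T) (e : {set T}) :
  [forall f in contract_hedges H e,
     (f \subset contract_verts H e) && (2 <= #|f|)].
Proof.
apply/forall_inP => _ /imsetP[f + ->]; rewrite inE => /andP[fH nfe].
apply/andP; split.
  apply/subsetP => _ /imsetP[x xf ->]; rewrite /contract_map /contract_verts.
  case: ifPn => xe; rewrite !inE //=.
  by apply: imset_f; rewrite inE xe (subsetP (hedge_sub fH)).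
have [x xf xe] := subsetPn nfe.
have [y] : exists y, y \in f :\ x.
  by apply/card_gt0P; have := hedge_card fH; rewrite (cardsD1 x) xf.
rewrite !inE => /andP[yx yf]; apply/card_gt1P.
exists (contract_map e x), (contract_map e y); split; try exact: imset_f.
rewrite /contract_map (negbTE xe); case: ifP => // _.
by apply: contra yx => /eqP[->].
Qed.

(* Meant for [e \in hedges H]. *)
Definition contract (T : finType) (H : hypergraph T) (e : {set T}) :
    hypergraph (option T) :=
  Hypergraph (contract_hedgesP H e).

(* [minor G H]: a hypergraph isomorphic to [G] is obtained from [H] by finitely
   many operations; the constructors perform the first operation on [H]. *)
Inductive minor (U : finType) (G : hypergraph U) :
    forall T : finType, hypergraph T -> Prop :=
| minor_iso (T : finType) (H : hypergraph T) :
    isomorphic H G -> minor G H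
| minor_sub (T : finType) (H H' : hypergraph T) :
    subhypergraph H' H -> minor G H' -> minor G H
| minor_contract (T : finType) (H : hypergraph T) (e : {set T}) :
    e \in hedges H -> minor G (contract H e) -> minor G H.

Definition independent (T : finType) (H : hypergraph T) (A : {set T}) : bool :=
  (A \subset verts H) && [forall e in hedges H, ~~ (e \subset A)].

Definition alpha (T : finType) (H : hypergraph T) : nat :=
  \max_(A : {set T} | independent H A) #|A|.

Definition color_class (T S : finType) (H : hypergraph T)
    (c : {ffun {x : T | x \in verts H} -> S}) (s : S) : {set T} :=
  [set val x | x : {x : T | x \in verts H} & c x == s].

Definition proper_coloring (T S : finType) (H : hypergraph T)
    (c : {ffun {x : T | x \in verts H} -> S}) : bool :=
  [forall s : S, independent H (color_class c s)].

Definition colorable (T : finType) (H : hypergraph T) (k : nat) : bool :=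
  [exists c : {ffun {x : T | x \in verts H} -> 'I_k}, proper_coloring c].

Lemma colorable_ex (T : finType) (H : hypergraph T) :
  exists k, colorable H k.
Proof.
exists #|{: {x : T | x \in verts H}}|; apply/existsP.
exists [ffun x => enum_rank x]; apply/forallP => s; apply/andP; split.
  by apply/subsetP => _ /imsetP[x _ ->]; apply: valP.
apply/forall_inP => e /hedge_card; apply: contraL => /subset_leq_card le_e.
rewrite -ltnNge ltnS; apply: leq_trans le_e (leq_trans (leq_imset_card _ _) _).
apply/card_le1_eqP => x y; rewrite !inE !ffunE => /eqP xs /eqP ys.
by apply: enum_rank_inj; rewrite xs.
Qed.

Definition chi (T : finType) (H : hypergraph T) : nat :=
  ex_minn (colorable_ex H).

(* Main.v *)
Require Import Defs.
From HB Require Import structures.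
From mathcomp Require Import all_boot all_order all_algebra.
From mathcomp Require Import zify lra.

Set Implicit Arguments.
Unset Strict Implicit.
Unset Printing Implicit Defensive.

(** Call two vertices a nonedge when they are distinct and do not form a
    hyperedge. A matching in the graph [F] of nonedges colours [H], with its
    edges and the unmatched vertices as colour classes. Restrict to an
    inclusion-minimal vertex set [A] on which every such colouring still needs
    [k = chi H] classes. Then every vertex of [A] is missed by some maximum
    matching, and Gallai's lemma applies: being missed together by no maximum
    matching is an equivalence relation on [A]. Its classes are mutually joined
    by hyperedges of size two, and if there are [m] of them, a maximum matching
    misses at most [m] vertices; hence [2 * k <= #|A| + m]
    ([gallai_partition]). This partition replaces the Tutte-Berge formula.

    It remains to find disjoint, connected, pairwise linked sets in [A], at least
    [(#|A| + m - 1) / 3] of them, since contracting each of them yields a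
    complete graph ([clique_model_minor]). As the independence number is at most
    two, any three vertices contain a hyperedge. Therefore a set containing
    a nonedge is linked to every nonempty set disjoint from it
    ([nonedge_dominates]), and a triple spanning an odd number of nonedges is
    connected ([odd_triple_connected]). When no such triple remains, the rest of a
    class is covered by two cliques, the larger of which is used vertex by vertex.
    A class [B] without such triples thus contributes at least [(#|B| + 1) / 3]
    sets, and any other class at least [#|B| / 3], one of them being a triple. Two
    classes of the latter kind are repaired together: a triple from each is
    traded for three pairs crossing between them ([surplus_join]). So at most
    one class falls short, by one third of a set, and
    [2 * k <= 3 * size Q + 1] for the resulting list [Q] ([chi_clique_seq]).
    Without a complete minor on [t] vertices, [size Q <= t - 1], which is the
    bound. *)

(** * Clique models and minors *)

(** The hyperedge witnessing the link may overlap both sets in several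
    vertices: once [X] and [Y] have been contracted to single vertices, its image
    has size exactly two. *)
Definition linked (T : finType) (H : hypergraph T) (X Y : {set T}) : bool :=
  [exists f in hedges H, [&& f \subset X :|: Y, f :&: X != set0 & f :&: Y != set0]].

Definition touching (T : finType) (H : hypergraph T) (S S' : {set T}) : bool :=
  [disjoint S & S'] && linked H S S'.

(** Connectivity by hyperedges lying inside [S]; this is what allows [S] to be
    contracted to a single vertex. *)
Definition connected (T : finType) (H : hypergraph T) (S : {set T}) : Prop :=
  forall X : {set T}, S :&: X != set0 -> S :\: X != set0 ->
    linked H (S :&: X) (S :\: X).

Definition clique_model (T : finType) (H : hypergraph T) (n : nat)
    (B : 'I_n -> {set T}) : Prop :=
  [/\ forall i, B i != set0, forall i, B i \subset verts H,
      forall i, connected H (B i)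
    & forall i j, i != j -> touching H (B i) (B j)].

Lemma linkedI (T : finType) (H : hypergraph T) (X Y f : {set T}) x y :
  f \in hedges H -> f \subset X :|: Y -> x \in f -> x \in X ->
  y \in f -> y \in Y -> linked H X Y.
Proof.
move=> fH fXY xf xX yf yY; apply/exists_inP; exists f => //; rewrite fXY /=.
by apply/andP; split; apply/set0Pn; [exists x | exists y]; rewrite inE ?xf ?yf.
Qed.

Lemma linkedP (T : finType) (H : hypergraph T) (X Y : {set T}) :
  linked H X Y -> exists f x y,
   [/\ f \in hedges H, f \subset X :|: Y, x \in f :&: X & y \in f :&: Y].
Proof.
case/exists_inP=> f fH /and3P[fXY /set0Pn[x xf] /set0Pn[y yf]].
by exists f, x, y.
Qed.

(** The separation hypothesis says that the contraction merges no vertex of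
    [X] with a vertex of [Y]. It prevents the witnessing hyperedge, which meets
    both, from lying inside [e] and thus from disappearing. *)
Lemma linked_contract (T : finType) (H : hypergraph T) (e X Y : {set T}) :
  (forall x y, x \in X -> y \in Y -> contract_map e x != contract_map e y) ->
  linked H X Y ->
  linked (contract H e) (contract_map e @: X) (contract_map e @: Y).
Proof.
move=> sep /linkedP[f [x [y [fH fXY]]]]; rewrite !inE => /andP[xf xX] /andP[yf yY].
apply: (@linkedI _ _ _ _ (contract_map e @: f) (contract_map e x) (contract_map e y));
  try exact: imset_f.
- apply/imsetP; exists f => //; rewrite inE fH /=.
  apply: contra (sep _ _ xX yY) => /subsetP fe.
  by rewrite /contract_map !fe.
- by rewrite -imsetU; apply: imsetS.
Qed.

(** A cut of the image of [S] pulls back to a cut of [S] that the contraction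
    does not blur, so a hyperedge crossing the latter survives. *)
Lemma contract_connected (T : finType) (H : hypergraph T) (e S : {set T}) :
  connected H S -> connected (contract H e) (contract_map e @: S).
Proof.
move=> cS X; set pi := contract_map e.
have -> : (pi @: S) :&: X = pi @: (S :&: (pi @^-1: X)).
  apply/setP => z; rewrite inE; apply/andP/imsetP.
    by case=> /imsetP[x xS ->] xX; exists x; rewrite // !inE xS.
  by case=> x; rewrite !inE => /andP[xS xX] ->; rewrite imset_f.
have -> : (pi @: S) :\: X = pi @: (S :\: (pi @^-1: X)).
  apply/setP => z; rewrite inE; apply/andP/imsetP.
    by case=> zX /imsetP[x xS zE]; exists x; rewrite // !inE xS -zE zX.
  by case=> x; rewrite !inE => /andP[xS xX] ->; rewrite imset_f.
rewrite !imset_eq0 => S1 S2; apply: linked_contract (cS _ S1 S2) => x y.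
rewrite !inE => /andP[_ xX] /andP[yX _].
by apply: contraNneq yX; rewrite /pi => <-.
Qed.

Lemma contract_model (T : finType) (H : hypergraph T) (n : nat)
    (B : 'I_n -> {set T}) (e : {set T}) (i : 'I_n) :
  e \subset B i -> e != set0 ->
  clique_model H B -> clique_model (contract H e) (fun j => contract_map e @: B j).
Proof.
move=> eB e0 [B0 BV Bc Bl].
have sep j k x y : j != k -> x \in B j -> y \in B k ->
    contract_map e x != contract_map e y.
  move=> jk xj yk; have /andP[djk _] := Bl _ _ jk.
  rewrite /contract_map; case: ifPn => xe; case: ifPn => ye //.
    (* [e] lies inside the single set [B i], so two different sets cannot both
       meet it. *)
    have out l z : z \in e -> z \in B l -> l = i.
      move=> ze zl; apply/eqP; apply: contraT => /Bl /andP[d _].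
      by have := disjointFr d zl; rewrite (subsetP eB).
    by rewrite (out _ _ xe xj) (out _ _ ye yk) eqxx in jk.
  by apply: contraTneq yk => -[<-]; rewrite (disjointFr djk xj).
split=> [j|j|j|j k jk].
- by rewrite imset_eq0.
- apply/subsetP => _ /imsetP[x xj ->]; rewrite /contract_map /= /contract_verts.
  case: ifPn => xe; rewrite !inE //=.
  by apply: imset_f; rewrite inE xe (subsetP (BV j)).
- exact: contract_connected.
- apply/andP; split.
    rewrite disjoint_subset; apply/subsetP => _ /imsetP[x xj ->].
    rewrite inE; apply/imsetP => -[y yk]; apply/eqP; exact: sep xj yk.
  apply: linked_contract => [x y|]; first exact: sep.
  by have /andP[] := Bl _ _ jk.
Qed.

Lemma card_contract_image (T : finType) (e : {set T}) :
  2 <= #|e| -> forall A : {set T}, e \subset A ->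
   #|contract_map e @: A| < #|A|.
Proof.
move=> e2 A eA; rewrite ltn_neqAle leq_imset_card andbT.
apply/negP => /imset_injP inj.
have /card_gt1P[x [y [xe ye]]] := e2.
case/eqP; apply: inj; rewrite ?(subsetP eA) //.
by rewrite /contract_map xe ye.
Qed.

(** The complete graph on [D]; it serves as the last subhypergraph, all
    hyperedges of other sizes being dropped there. *)
Lemma pair_hypergraphP (T : finType) (D : {set T}) :
  [forall e in [set e : {set T} | (e \subset D) && (#|e| == 2)],
     (e \subset D) && (2 <= #|e|)].
Proof. by apply/forall_inP => e; rewrite inE => /andP[-> /eqP->]. Qed.

Lemma singleton_model (T : finType) (H : hypergraph T) (n : nat) (p : 'I_n -> T) :
  (forall i, p i \in verts H) -> injective p ->
  (forall i j, i != j -> [set p i; p j] \in hedges H) ->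
  minor (complete_graph n) H.
Proof.
move=> pV pI pE.
apply: (@minor_sub _ _ _ _ (Hypergraph (pair_hypergraphP (p @: 'I_n)))).
  apply/andP; split; first by apply/subsetP => _ /imsetP[i _ ->].
  apply/subsetP => e /=; rewrite inE => /andP[/subsetP sub /cards2P[x [y [xy E]]]].
  have /imsetP[i _ xi] := sub x (ltac:(by rewrite E !inE eqxx)).
  have /imsetP[j _ yj] := sub y (ltac:(by rewrite E !inE eqxx orbT)).
  by rewrite E xi yj; apply: pE; apply: contraNneq xy => ij; rewrite xi yj ij.
apply: minor_iso.
pose G := Hypergraph (pair_hypergraphP (p @: 'I_n)).
have inG (y : {y : 'I_n | y \in verts (complete_graph n)}) : p (val y) \in verts G.
  exact: imset_f.
pose g y : {x | x \in verts G} := exist (fun x => x \in verts G) _ (inG y).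
have gI : injective g by move=> y z /(congr1 val) /pI /val_inj.
have gS x : exists y, g y == x.
  case: x => x xG; have /imsetP[i _ xi] := xG.
  by exists (exist (fun i => i \in verts (complete_graph n)) i (in_setT i)); rewrite -val_eqE /= xi.
pose f x := xchoose (gS x).
have fK : cancel f g by move=> x; apply/eqP; exact: (xchooseP (gS x)).
have gK : cancel g f by move=> y; apply: gI; rewrite fK.
exists f; split; first by exists g.
move=> A; rewrite !inE !(card_imset _ val_inj) ?(card_imset _ (can_inj fK)).
rewrite andbC; case: eqP => //= _.
by apply/subsetP => _ /imsetP[x _ ->]; apply: (valP x).
Qed.

(** Contracting a hyperedge inside a set of size at least two keeps a clique
    model and decreases the total size of its sets. When all sets are singletons,
    a link between two of them is a hyperedge of size two. *)
Lemma clique_model_minor (n : nat) (T : finType) (H : hypergraph T)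
    (B : 'I_n -> {set T}) :
  clique_model H B -> minor (complete_graph n) H.
Proof.
have [m] := ubnP (\sum_i #|B i|).
elim: m T H B => // m IH T H B le_m mod.
have [B0 BV Bc Bl] := mod.
case: (boolP [exists i, 1 < #|B i|]) => [/existsP[i Bi]|].
  have /card_gt1P[x [y [xB yB xy]]] := Bi.
  have /linkedP[e [_ [_ [eH eB _ _]]]] : linked H (B i :&: [set x]) (B i :\: [set x]).
    apply: Bc; apply/set0Pn; [exists x | exists y]; rewrite !inE ?xB ?eqxx //.
    by rewrite yB andbT eq_sym.
  rewrite setID in eB.
  have e2 := hedge_card eH.
  apply: (minor_contract eH); apply: (IH _ _ (fun j => contract_map e @: B j)).
    rewrite -ltnS; apply: leq_trans le_m; rewrite ltnS.
    rewrite (bigD1 i) // [X in _ < X](bigD1 i) //= -addSn.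
    apply: leq_add; first exact: card_contract_image.
    by apply: leq_sum => j _; apply: leq_imset_card.
  by apply: contract_model eB _ mod; rewrite -card_gt0 ltnW.
rewrite negb_exists => /forallP B1.
have Bp i : exists x, B i == [set x].
  have /cards1P[x ->] : #|B i| == 1 by rewrite eqn_leq card_gt0 B0 leqNgt B1.
  by exists x.
pose p i := xchoose (Bp i).
have BE i : B i = [set p i] by apply/eqP; exact: (xchooseP (Bp i)).
apply: (@singleton_model _ _ _ p) => [i|i j pij|i j ij].
- by rewrite (subsetP (BV i)) // BE inE.
- apply/eqP; apply: contraT => /Bl /andP[].
  by rewrite !BE pij disjoints1 inE eqxx.
- have /andP[_ /linkedP[f [x [y [fH]]]]] := Bl _ _ ij.
  rewrite !BE !inE => fs /andP[xf /eqP xE] /andP[yf /eqP yE].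
  suff -> : [set p i; p j] = f by [].
  apply/eqP; rewrite eqEsubset fs andbT; apply/subsetP => z.
  by rewrite !inE => /orP[]/eqP->; rewrite -?xE -?yE.
Qed.

(** * Matchings *)

(** A matching is encoded as an involution that moves vertices only along [F],
    its fixed points being the unmatched vertices; requiring moved vertices to
    lie in [A] makes it a matching of the induced graph on [A]. *)
Definition matching (T : finType) (F : rel T) (A : {set T}) (f : {ffun T -> T}) : bool :=
  [forall x, f (f x) == x] && [forall x, (f x != x) ==> (x \in A) && F x (f x)].

Definition missed (T : finType) (A : {set T}) (f : {ffun T -> T}) : {set T} :=
  [set x in A | f x == x].

(** One vertex for each unmatched vertex and for each matched pair, namely the
    one of smaller rank; these are the classes of the colouring given by [f]. *)
Definition leaders (T : finType) (A : {set T}) (f : {ffun T -> T}) : {set T} :=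
  [set x in A | enum_rank x <= enum_rank (f x)].

Lemma matchingP (T : finType) (F : rel T) (A : {set T}) (f : {ffun T -> T}) :
  reflect (involutive f /\ forall x, f x != x -> x \in A /\ F x (f x))
          (matching F A f).
Proof.
apply: (iffP andP) => -[].
  move=> /forallP fK /forallP fF; split=> [x|x fx]; first exact/eqP.
  by have /implyP/(_ fx)/andP := fF x.
move=> fK fF; split; apply/forallP => x; first exact/eqP.
by apply/implyP => /fF[-> ->].
Qed.

Lemma matching_in (T : finType) (F : rel T) (A : {set T}) (f : {ffun T -> T}) x :
  matching F A f -> x \in A -> f x \in A.
Proof.
case/matchingP=> fK fF xA; have [->//|fx] := eqVneq (f x) x.
have [] // : f x \in A /\ F (f x) (f (f x)); apply: fF.
by rewrite fK eq_sym.
Qed.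

(** The leaders and their images under [f] cover [A] and overlap exactly in
    the unmatched vertices. *)
Lemma card_leaders (T : finType) (F : rel T) (A : {set T}) (f : {ffun T -> T}) :
  matching F A f -> #|A| + #|missed A f| = (#|leaders A f|).*2.
Proof.
move=> fM; have [fK _] := matchingP _ _ _ fM.
have fA x : (f x \in A) = (x \in A).
  by apply/idP/idP => /(matching_in fM); rewrite ?fK.
have AE : A = leaders A f :|: f @: leaders A f.
  apply/setP => x; rewrite !inE; apply/idP/idP => [xA|/orP[/andP[]//|]].
    rewrite xA /=; case: leqP => //= xx; apply/imsetP; exists (f x); rewrite ?fK //.
    by rewrite inE fA xA fK ltnW.
  by case/imsetP=> y; rewrite inE => /andP[yA _] ->; rewrite fA.
have mE : missed A f = leaders A f :&: f @: leaders A f.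
  apply/setP => x; rewrite !inE; case: (boolP (x \in A)) => //= xA.
  apply/eqP/andP => [fx|[le1 /imsetP[y]]].
    split; first by rewrite fx.
    by apply/imsetP; exists x; rewrite ?fx // inE xA fx leqnn.
  rewrite inE => /andP[yA le2] xE; apply: enum_rank_inj; apply: val_inj; apply/eqP.
  by rewrite eqn_leq le1 andbT xE fK.
rewrite [in #|A|]AE mE cardsUI card_imset ?addnn //.
exact: inv_inj fK.
Qed.

(** By [card_leaders], this says that every partition of [A] into single vertices
    and edges of [F] has at least [k] parts; it is stated through the number
    of unmatched vertices, which is the quantity to be bounded. *)
Definition needs (T : finType) (F : rel T) (k : nat) (A : {set T}) : bool :=
  [forall f : {ffun T -> T}, matching F A f ==> (k.*2 <= #|A| + #|missed A f|)].

Definition tight (T : finType) (F : rel T) (k : nat) (A : {set T})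
    (f : {ffun T -> T}) : bool :=
  matching F A f && (#|A| + #|missed A f| == k.*2).

(** Criticality: without [v] there is a partition into at most [k - 1] parts, and
    putting [v] back as an unmatched vertex adds one part. *)
Lemma minimal_needs (T : finType) (F : rel T) (k : nat) (A : {set T}) :
  minset (needs F k) A ->
  forall v, v \in A -> exists2 f, tight F k A f & f v = v.
Proof.
move=> /minsetP[Ah Amin] v vA.
have /forallPn[f] : ~~ needs F k (A :\ v).
  apply/negP => /Amin; rewrite subD1set => /(_ isT) E.
  by move: vA; rewrite -E !inE eqxx.
rewrite negb_imply -ltnNge => /andP[fM lt_k].
have [fK fF] := matchingP _ _ _ fM.
have fv : f v = v by apply/eqP; apply: contraT => /fF[]; rewrite !inE eqxx.
have fMA : matching F A f.
  by apply/matchingP; split=> // x /fF[]; rewrite inE => /andP[].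
exists f => //; rewrite /tight fMA /=.
have := forallP Ah f; rewrite fMA /=.
move: lt_k; have := card_leaders fMA; rewrite (card_leaders fM).
have -> : #|leaders A f| = #|leaders (A :\ v) f|.+1.
  have -> : leaders A f = v |: leaders (A :\ v) f.
    by apply/setP => x; rewrite !inE; case: eqVneq => // ->; rewrite fv leqnn vA.
  by rewrite cardsU1 !inE eqxx.
lia.
Qed.

(** * Gallai's lemma for vertex-critical graphs *)

Section Gallai.

Variables (T : finType) (F : rel T) (k : nat) (A : {set T}).
Hypothesis Fsym : symmetric F.
Hypothesis Aneeds : needs F k A.
Hypothesis Acritical : forall v, v \in A -> exists2 f, tight F k A f & f v = v.

(** Otherwise adding the edge [xy] to the matching would save one part. *)
Lemma tight_covers_edge f x y :
  tight F k A f -> x \in A -> y \in A -> x != y -> F x y -> f x = x -> f y != y.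
Proof.
case/andP=> fM /eqP fk xA yA xy Fxy fx; apply/eqP => fy.
have [fK fF] := matchingP _ _ _ fM.
pose g := [ffun u => if u == x then y else if u == y then x else f u].
have gx : g x = y by rewrite ffunE eqxx.
have gy : g y = x by rewrite ffunE eqxx eq_sym (negPf xy).
have gE u : u != x -> u != y -> g u = f u.
  by move=> ux uy; rewrite ffunE (negPf ux) (negPf uy).
have gM : matching F A g.
  apply/matchingP; split=> u; case: (eqVneq u x) => [->|ux]; rewrite ?gx ?gy //;
    case: (eqVneq u y) => [->|uy]; rewrite ?gx ?gy //; last by rewrite gE //; apply: fF.
    rewrite (gE u) // gE ?fK //.
      by rewrite -[x]fx (inj_eq (inv_inj fK)).
    by rewrite -[y]fy (inj_eq (inv_inj fK)).
  by rewrite Fsym.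
have := forallP Aneeds g; rewrite gM -fk leq_add2l leqNgt => /negP; apply.
apply: proper_card; apply/properP; split.
  apply/subsetP => u; rewrite !inE ffunE => /andP[->] /=.
  case: (eqVneq u x) => [->|ux]; first by rewrite eq_sym (negPf xy).
  by case: (eqVneq u y) => [->|//]; rewrite (negPf xy).
by exists x; rewrite !inE ?fx ?xA ?eqxx // ffunE eqxx eq_sym (negPf xy) andbF.
Qed.

(** The exchange step of Gallai's lemma: with [y := M x] and [z := N y], replace
    the edge [yz] of [N] by the edge [xy] of [M]. This keeps the number of
    unmatched vertices and makes [N] agree with [M] on more vertices. *)
Lemma tight_switch M N w x :
  tight F k A M -> tight F k A N -> N w = w -> x != w -> N x = x -> M x != x ->
  exists2 N', tight F k A N' /\ N' w = w &
    #|[set u | M u == N u]| < #|[set u | M u == N' u]|.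
Proof.
move=> Mt Nt Nw xw Nx Mx.
have /andP[MM _] := Mt; have /andP[NM /eqP Nk] := Nt.
have [MK MF] := matchingP _ _ _ MM; have [NK NF] := matchingP _ _ _ NM.
set y := M x; have yx : y != x by [].
have [xA Fxy] := MF _ Mx.
(* [N] misses [x], so it cannot also miss the neighbour [y] of [x]. *)
have yA : y \in A by apply: matching_in MM _.
have Ny : N y != y by apply: (tight_covers_edge Nt xA) => //; rewrite eq_sym.
set z := N y.
have zx : z != x by rewrite -[x in _ != x]Nx (inj_eq (inv_inj NK)).
have zA : z \in A by apply: matching_in NM _.
have yw : y != w by apply: contraNneq Ny => ->; rewrite Nw.
have zw : z != w by rewrite -[w]Nw (inj_eq (inv_inj NK)).
have My : M y = x by rewrite /y MK.
have Nz : N z = y by rewrite /z NK.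
pose g := [ffun u => if u == x then y else if u == y then x else
                     if u == z then z else N u].
have gx : g x = y by rewrite ffunE eqxx.
have gy : g y = x by rewrite ffunE eqxx (negPf yx).
have gz : g z = z by rewrite ffunE (negPf zx) (negPf Ny) eqxx.
have gE u : u != x -> u != y -> u != z -> g u = N u.
  by move=> ux uy uz; rewrite ffunE (negPf ux) (negPf uy) (negPf uz).
have gM : matching F A g.
  apply/matchingP; split=> u.
    case: (eqVneq u x) => [->|ux]; first by rewrite gx gy.
    case: (eqVneq u y) => [->|uy]; first by rewrite gy gx.
    case: (eqVneq u z) => [->|uz]; first by rewrite gz gz.
    rewrite (gE u) // gE ?NK //.
    - by rewrite -[x]Nx (inj_eq (inv_inj NK)).
    - by rewrite -Nz (inj_eq (inv_inj NK)).
    - by rewrite (inj_eq (inv_inj NK)).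
  case: (eqVneq u x) => [->|ux]; first by rewrite gx.
  case: (eqVneq u y) => [->|uy]; first by rewrite gy Fsym.
  case: (eqVneq u z) => [->|uz]; first by rewrite gz eqxx.
  by rewrite gE //; apply: NF.
exists g.
  split; last by rewrite gE // eq_sym.
  rewrite /tight gM -Nk eqn_add2l /=; apply/eqP.
  have -> : missed A g = z |: (missed A N :\ x).
    apply/setP => u; rewrite !inE.
    case: (eqVneq u x) => [->|ux]; first by rewrite gx (negPf yx) andbF eq_sym (negPf zx).
    case: (eqVneq u z) => [->|uz]; first by rewrite gz eqxx zA.
    case: (eqVneq u y) => [->|uy]; last by rewrite gE.
    by rewrite gy eq_sym (negPf yx) -/z (negPf Ny) !andbF.
  by rewrite cardsU1 (cardsD1 x (missed A N)) !inE xA Nx Nz eqxx [y == z]eq_sym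
     (negPf Ny) !andbF.
apply: proper_card; apply/properP; split.
  apply/subsetP => u; rewrite !inE => /eqP MN.
  case: (eqVneq u x) MN => [->|ux]; first by rewrite Nx => E; rewrite E eqxx in Mx.
  case: (eqVneq u y) => [->|uy]; first by rewrite My -/z => E; rewrite E eqxx in zx.
  case: (eqVneq u z) => [->|uz]; last by rewrite gE // => ->.
  by rewrite Nz => E; case/eqP: zx; rewrite -My -E MK.
by exists x; rewrite !inE ?gx ?eqxx // Nx.
Qed.

(** Equal, or missed together by no optimal matching. By [tight_covers_edge] it
    contains [F], so its classes are unions of components of [F]; working with it
    dispenses with paths in [F]. *)
Definition inseparable u v := (u == v) ||
  [forall f, tight F k A f ==> ~~ ((f u == u) && (f v == v))].

Lemma inseparable_sym u v : inseparable u v = inseparable v u.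
Proof.
rewrite /inseparable eq_sym; congr (_ || _); apply: eq_forallb => f.
by rewrite andbC.
Qed.

(** Suppose that an optimal [M] misses [u] and [v], and take an optimal [N]
    missing [w] that agrees with [M] as much as possible. Then [N] covers [u]
    and [v]; as [M] and [N] miss equally many vertices, [N] also misses some
    [x != w] covered by [M], and [tight_switch] increases the agreement. *)
Lemma inseparable_trans u v w : u \in A -> v \in A -> w \in A ->
  inseparable u w -> inseparable w v -> inseparable u v.
Proof.
move=> uA vA wA; rewrite /inseparable.
case: (eqVneq u w) => [->//|uw]; case: (eqVneq w v) => [<-|wv].
  by rewrite (negPf uw).
case: (eqVneq u v) => //= uv /forallP Ruw /forallP Rwv.
apply/forallP => M; apply/implyP => Mt; apply/negP => /andP[/eqP Mu /eqP Mv].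
have [N Nt Nw] := Acritical wA.
have [n] := ubnP (#|T| - #|[set x | M x == N x]|).
elim: n N Nt Nw => // n IH N Nt Nw lt_n.
have Nu : N u != u by have := Ruw N; rewrite Nt Nw eqxx andbT.
have Nv : N v != v by have := Rwv N; rewrite Nt Nw eqxx.
have /andP[_ /eqP Mk] := Mt; have /andP[_ /eqP Nk] := Nt.
have [x] : exists x, x \in (missed A N :\: missed A M) :\ w.
  apply/set0Pn; rewrite -card_gt0.
  have : 2 <= #|missed A M :\: missed A N|.
    apply/card_gt1P; exists u, v; split=> //.
      by rewrite !inE uA Mu (negPf Nu) eqxx.
    by rewrite !inE vA Mv (negPf Nv) eqxx.
  have -> : #|missed A M :\: missed A N| = #|missed A N :\: missed A M|.
    apply/eqP; rewrite -(eqn_add2l #|missed A M :&: missed A N|) cardsID.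
    by rewrite setIC cardsID -(eqn_add2l #|A|) Mk Nk.
  by rewrite (cardsD1 w); case: (w \in _) => // /ltnW.
rewrite !inE => /and3P[xw xM /andP[xA /eqP Nx]]; rewrite xA /= in xM.
have [N' [N't N'w] lt_N] := tight_switch Mt Nt Nw xw Nx xM.
apply: (IH _ N't N'w).
apply: leq_trans (ltn_sub2l _ lt_N) _; last by rewrite -ltnS.
exact: leq_trans lt_N (max_card _).
Qed.

(** An optimal matching misses at most one vertex in each class of
    [inseparable], so [#|P|] bounds its number of unmatched vertices. *)
Lemma gallai_partition :
  exists P : {set {set T}}, [/\ partition P A,
    forall B C x y, B \in P -> C \in P -> B != C -> x \in B -> y \in C -> ~~ F x y
    & k.*2 <= #|A| + #|P|].
Proof.
pose P := equivalence_partition inseparable A.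
have Req : {in A & &, equivalence_rel inseparable}.
  move=> x y z xA yA zA; split=> [|xy]; first by rewrite /inseparable eqxx.
  apply/idP/idP; last exact: inseparable_trans.
  by apply: inseparable_trans => //; rewrite inseparable_sym.
have Ppart : partition P A by apply: equivalence_partitionP.
have /and3P[/eqP cov triv _] := Ppart.
have blk x y : x \in A -> y \in A -> (y \in pblock P x) = inseparable x y.
  by move=> xA yA; apply: pblock_equivalence_partition.
exists P; split=> // [B C x y BP CP BC xB yC|].
  have xA : x \in A by rewrite -cov; apply/bigcupP; exists B.
  have yA : y \in A by rewrite -cov; apply/bigcupP; exists C.
  apply: contra BC => Fxy.
  rewrite -(def_pblock triv BP xB) -(def_pblock triv CP yC).
  rewrite eq_pblock ?cov // blk // /inseparable.
  case: (eqVneq x y) => //= xy; apply/forallP => f; apply/implyP => ft.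
  apply/negP => /andP[/eqP fx]; apply/negP.
  exact: tight_covers_edge ft xA yA xy Fxy fx.
(* With [A] empty, criticality provides no matching; the identity does. *)
have [A0|[v vA]] := set_0Vmem A.
  have := forallP Aneeds [ffun x => x].
  have -> : matching F A [ffun x => x].
    by apply/matchingP; split=> x; rewrite !ffunE // eqxx.
  move=> /implyP/(_ isT) /leq_trans -> //; rewrite leq_add2l.
  suff -> : missed A [ffun x => x] = set0 by rewrite cards0.
  by apply/setP => x; rewrite A0 !inE.
have [f ft _] := Acritical vA; have /andP[_ /eqP <-] := ft.
rewrite leq_add2l -(card_in_imset (f := pblock P) (D := mem (missed A f))).
  apply: subset_leq_card; apply/subsetP => _ /imsetP[x + ->].
  by rewrite inE => /andP[xA _]; apply: pblock_mem; rewrite cov.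
move=> x y; rewrite !inE => /andP[xA /eqP fx] /andP[yA /eqP fy] E.
have : inseparable x y by rewrite -blk // E mem_pblock cov.
by case/orP=> [/eqP//|/forallP/(_ f)]; rewrite ft fx fy !eqxx.
Qed.

End Gallai.

(** * Cliques of touching sets *)

(** A list version of [clique_model], suited to gluing models of different parts;
    the members lie in [A]. *)
Definition clique_seq (T : finType) (H : hypergraph T) (A : {set T})
    (Q : seq {set T}) : Prop :=
  [/\ {in Q, forall S, S != set0 /\ S \subset A}, {in Q, forall S, connected H S}
    & pairwise (touching H) Q].

Definition joined (T : finType) (H : hypergraph T) (A B : {set T}) : Prop :=
  {in A & B, forall x y, [set x; y] \in hedges H}.

(** When [H] has independence number at most two, its colour classes are single
    vertices and pairs in this relation. *)
Definition nonedge (T : finType) (H : hypergraph T) : rel T :=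
  fun x y => (x != y) && ([set x; y] \notin hedges H).

Lemma nonedge_sym (T : finType) (H : hypergraph T) : symmetric (nonedge H).
Proof. by move=> x y; rewrite /nonedge eq_sym setUC. Qed.

Lemma linkedC (T : finType) (H : hypergraph T) (X Y : {set T}) :
  linked H X Y = linked H Y X.
Proof.
by apply: eq_existsb => f; rewrite (setUC X); congr (_ && (_ && _)); apply: andbC.
Qed.

Lemma touchingC (T : finType) (H : hypergraph T) (X Y : {set T}) :
  touching H X Y = touching H Y X.
Proof. by rewrite /touching disjoint_sym linkedC. Qed.

Lemma linked_edge (T : finType) (H : hypergraph T) (X Y : {set T}) x y :
  [set x; y] \in hedges H -> x \in X -> y \in Y -> linked H X Y.
Proof.
move=> xyH xX yY; apply: (linkedI xyH _ (set21 x y) xX (set22 x y) yY).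
by rewrite subUset !sub1set !inE xX yY orbT.
Qed.

Lemma edge_neq (T : finType) (H : hypergraph T) x y :
  [set x; y] \in hedges H -> x != y.
Proof. by move/hedge_card; rewrite cards2; case: (x != y). Qed.

Lemma joined_disjoint (T : finType) (H : hypergraph T) (A B : {set T}) :
  joined H A B -> [disjoint A & B].
Proof.
move=> AB; rewrite disjoint_subset; apply/subsetP => x xA; rewrite inE.
by apply/negP => xB; have := edge_neq (AB _ _ xA xB); rewrite eqxx.
Qed.

Lemma joinedC (T : finType) (H : hypergraph T) (A B : {set T}) :
  joined H A B -> joined H B A.
Proof. by move=> AB x y xB yA; rewrite setUC; apply: AB. Qed.

Lemma joined_touching (T : finType) (H : hypergraph T) (A B S S' : {set T}) :
  joined H A B -> S != set0 -> S \subset A -> S' != set0 -> S' \subset B ->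
  touching H S S'.
Proof.
move=> AB /set0Pn[x xS] SA /set0Pn[y yS'] S'B; apply/andP; split.
  exact: disjointW SA S'B (joined_disjoint AB).
have xy := AB x y (subsetP SA x xS) (subsetP S'B y yS').
exact: linked_edge xy xS yS'.
Qed.

Lemma clique_seq_cons (T : finType) (H : hypergraph T) (A S : {set T}) Q :
  S != set0 -> S \subset A -> connected H S -> {in Q, forall S', touching H S S'} ->
  clique_seq H A Q -> clique_seq H A (S :: Q).
Proof.
move=> S0 SA Sc SQ [Q1 Q2 Q3]; split=> [S'|S'|].
- by rewrite inE => /orP[/eqP->//|/Q1].
- by rewrite inE => /orP[/eqP->//|/Q2].
- by rewrite pairwise_cons Q3 andbT; apply/allP.
Qed.

Lemma clique_seq_behead (T : finType) (H : hypergraph T) (A S : {set T}) Q :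
  clique_seq H A (S :: Q) ->
  [/\ S != set0, S \subset A, {in Q, forall S', touching H S S'} & clique_seq H A Q].
Proof.
case=> Q1 Q2 Q3; have [] := Q1 S (mem_head _ _).
move: Q3; rewrite pairwise_cons => /andP[/allP SQ Q3] S0 SA.
by split=> //; split=> // S' S'Q; [apply: Q1|apply: Q2]; rewrite inE S'Q orbT.
Qed.

Lemma clique_seq_sub (T : finType) (H : hypergraph T) (A A' : {set T}) Q :
  A \subset A' -> clique_seq H A Q -> clique_seq H A' Q.
Proof.
move=> AA' [Q1 Q2 Q3]; split=> // S /Q1[S0 SA]; split=> //; exact: subset_trans AA'.
Qed.

Lemma clique_seq_cat (T : finType) (H : hypergraph T) (A B : {set T}) Q R :
  joined H A B -> clique_seq H A Q -> clique_seq H B R ->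
  clique_seq H (A :|: B) (Q ++ R).
Proof.
move=> AB [Q1 Q2 Q3] [R1 R2 R3]; split=> [S|S|].
- rewrite mem_cat => /orP[/Q1|/R1] [S0 SA]; split=> //.
    exact: subset_trans SA (subsetUl _ _).
  exact: subset_trans SA (subsetUr _ _).
- by rewrite mem_cat => /orP[/Q2|/R2].
- rewrite pairwise_cat Q3 R3 !andbT; apply/allrelP => S S' /Q1[S0 SA] /R1[S'0 S'B].
  exact: joined_touching AB S0 SA S'0 S'B.
Qed.

Lemma clique_seq_minor (T : finType) (H : hypergraph T) Q n :
  clique_seq H (verts H) Q -> n <= size Q -> minor (complete_graph n) H.
Proof.
move=> [Q1 Q2 Q3] le_n.
have inQ (i : 'I_n) : nth set0 Q i \in Q by rewrite mem_nth // (leq_trans _ le_n).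
apply: (@clique_model_minor _ _ _ (fun i => nth set0 Q i)).
split=> [i|i|i|i j ij]; try by have [] := Q1 _ (inQ i).
  exact: Q2.
have lt (k : 'I_n) : (k : nat) \in gtn (size Q) by rewrite inE (leq_trans _ le_n).
have Qp := pairwiseP set0 Q3.
case: (ltngtP i j) => [l|l|/val_inj E].
- exact: Qp.
- by rewrite touchingC; apply: Qp.
- by rewrite E eqxx in ij.
Qed.

(** * Small connected and dominating sets *)

Lemma hedge_connected (T : finType) (H : hypergraph T) (e : {set T}) :
  e \in hedges H -> connected H e.
Proof.
move=> eH X /set0Pn[x xX] /set0Pn[y yX].
apply: (linkedI eH _ _ xX _ yX); first by rewrite setID.
  by case/setIP: xX.
by case/setDP: yX.
Qed.

Lemma set1_connected (T : finType) (H : hypergraph T) (x : T) : connected H [set x].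
Proof.
move=> X /set0Pn[y]; rewrite !inE => /andP[/eqP-> xX] /set0Pn[z].
by rewrite !inE => /andP[zX /eqP zx]; rewrite zx xX in zX.
Qed.

Lemma star_connected (T : finType) (H : hypergraph T) (S : {set T}) (z : T) :
  z \in S -> {in S, forall x, x != z -> [set x; z] \in hedges H} -> connected H S.
Proof.
move=> zS star X /set0Pn[x]; rewrite !inE => /andP[xS xX] /set0Pn[y].
rewrite !inE => /andP[yX yS]; case: (boolP (z \in X)) => zX.
  rewrite linkedC; apply: (@linked_edge _ _ _ _ y z); rewrite ?inE ?yX ?zX ?zS //.
  by apply: star => //; apply: contraNneq yX => ->.
apply: (@linked_edge _ _ _ _ x z); rewrite ?inE ?xX ?zX ?zS ?xS //.
by apply: star => //; apply: contraNneq zX => <-.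
Qed.

Lemma cards3 (T : finType) (x y z : T) :
  x != y -> x != z -> y != z -> #|[set x; y; z]| = 3.
Proof.
by move=> xy xz yz; rewrite setUC cardsU1 cards2 !inE negb_or ![z == _]eq_sym xz yz xy.
Qed.

Lemma triple_hedge (T : finType) (H : hypergraph T) x y z :
  alpha H <= 2 -> x \in verts H -> y \in verts H -> z \in verts H ->
  x != y -> x != z -> y != z -> exists2 e, e \in hedges H & e \subset [set x; y; z].
Proof.
move=> a2 xV yV zV xy xz yz.
case: (boolP [exists e in hedges H, e \subset [set x; y; z]]) => [/exists_inP//|no].
have ind : independent H [set x; y; z].
  apply/andP; split.
    by apply/subsetP => u; rewrite !inE => /orP[/orP[]|]/eqP->.
  apply/forall_inP => e eH; apply: contra no => eS; apply/exists_inP; by exists e.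
have := leq_trans (leq_bigmax_cond (F := fun A : {set T} => #|A|) _ ind) a2.
by rewrite cards3.
Qed.

(** With [z] in [S'], some hyperedge lies in [{x, y, z}]. It has at least two
    vertices and is not [{x, y}], so it contains [z] and one of [x] and [y]. *)
Lemma nonedge_dominates (T : finType) (H : hypergraph T) (S S' : {set T}) x y :
  alpha H <= 2 -> S \subset verts H -> S' \subset verts H -> S' != set0 ->
  [disjoint S & S'] -> x \in S -> y \in S -> nonedge H x y -> touching H S S'.
Proof.
move=> a2 SV S'V /set0Pn[z zS'] dis xS yS /andP[xy xyN].
rewrite /touching dis /=.
have zS : z \notin S by rewrite (disjointFl dis zS').
have xz : x != z by apply: contraNneq zS => <-.
have yz : y != z by apply: contraNneq zS => <-.
have [e eH eS] := triple_hedge a2 (subsetP SV _ xS) (subsetP SV _ yS)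
  (subsetP S'V _ zS') xy xz yz.
have e2 := hedge_card eH.
have ze : z \in e.
  apply: contraNT xyN => ze; suff <- : e = [set x; y] by [].
  apply/eqP; rewrite eqEcard cards2 xy e2 andbT; apply/subsetP => u ue.
  have := subsetP eS _ ue; rewrite !inE => /orP[//|/eqP uz].
  by rewrite -uz ue in ze.
have [u] : exists u, u \in e :\ z.
  by apply/set0Pn; rewrite -card_gt0; rewrite (cardsD1 z) ze in e2.
rewrite !inE => /andP[uz ue].
have uS : u \in S.
  by have := subsetP eS _ ue; rewrite !inE (negPf uz) orbF => /orP[]/eqP->.
apply: (linkedI eH _ ue uS ze zS'); apply/subsetP => w /(subsetP eS).
by rewrite !inE => /orP[/orP[]|]/eqP->; rewrite ?xS ?yS ?zS' ?orbT.
Qed.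

(** The hypotheses say that the triple spans one or three nonedges. With three,
    no pair is a hyperedge, so the triple itself is one; with only [xy], the
    pairs [xz] and [yz] form a path. *)
Lemma odd_triple_connected (T : finType) (H : hypergraph T) x y z :
  alpha H <= 2 -> x \in verts H -> y \in verts H -> z \in verts H ->
  x != z -> y != z -> nonedge H x y -> nonedge H y z = nonedge H x z ->
  connected H [set x; y; z].
Proof.
move=> a2 xV yV zV xz yz Nxy Nz; have /andP[xy xyN] := Nxy.
case: (boolP (nonedge H x z)) Nz => [/andP[_ xzN] /andP[_ yzN]|].
  have [e eH eS] := triple_hedge a2 xV yV zV xy xz yz.
  suff <- : e = [set x; y; z] by apply: hedge_connected.
  apply/eqP; rewrite eqEsubset eS; apply: contraT => /subsetPn[u uS ue].
  have e2 := hedge_card eH.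
  have eD : e = [set x; y; z] :\ u.
    apply/eqP; rewrite eqEcard subsetD1 eS ue /=.
    have := cards3 xy xz yz.
    by rewrite (cardsD1 u) uS add1n => -[->].
  have : e \notin hedges H; last by rewrite eH.
  move: uS; rewrite !inE => /orP[/orP[]|]/eqP uE.
  - suff -> : e = [set y; z] by [].
    apply/setP => w; rewrite eD uE !inE; case: (eqVneq w x) => [->|] //=.
    by rewrite (negPf xy) (negPf xz).
  - suff -> : e = [set x; z] by [].
    apply/setP => w; rewrite eD uE !inE; case: (eqVneq w y) => [->|] //=.
      by rewrite eq_sym (negPf xy) (negPf yz).
    by rewrite orbF.
  - suff -> : e = [set x; y] by [].
    apply/setP => w; rewrite eD uE !inE; case: (eqVneq w z) => [->|] //=.
      by rewrite ![z == _]eq_sym (negPf xz) (negPf yz).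
    by rewrite orbF.
rewrite /nonedge xz yz /= !negbK => xzE yzE.
apply: (@star_connected _ _ _ z); first by rewrite !inE eqxx orbT.
move=> u; rewrite !inE => /orP[/orP[]|]/eqP-> //; last by rewrite eqxx.
by move/negbFE: yzE.
Qed.

Lemma clique_seq_singletons (T : finType) (H : hypergraph T) (A : {set T}) :
  {in A &, forall x y, ~~ nonedge H x y} ->
  clique_seq H A [seq [set x] | x <- enum A].
Proof.
move=> cl; split=> [S|S|].
- case/mapP=> x; rewrite mem_enum => xA ->; split; last by rewrite sub1set.
  by apply/set0Pn; exists x; rewrite inE.
- by case/mapP=> x _ ->; apply: set1_connected.
- rewrite pairwise_map; have := enum_uniq A; rewrite uniq_pairwise.
  apply: sub_in_pairwise (allss _) => x y; rewrite -!topredE /= !mem_enum => xA yA xy.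
  rewrite /touching disjoints1 inE xy /=.
  have := cl x y xA yA; rewrite /nonedge xy negbK => E.
  by apply: linked_edge E _ _; rewrite inE.
Qed.

(** Three vertices spanning an odd number of pairs of a symmetric [F] can be
    ordered so that one such pair is [xy] and the other two pairs agree. *)
Definition odd_triple (T : finType) (F : rel T) (x y z : T) : bool :=
  [&& x != z, y != z, F x y & F y z == F x z].

(** The vertices forming a nonedge with a fixed vertex are one clique and the
    remaining vertices another, since a nonedge inside either of them would form
    an odd triple with that vertex. *)
Lemma two_cliques (T : finType) (H : hypergraph T) (B : {set T}) :
  {in B & &, forall x y z, ~~ odd_triple (nonedge H) x y z} ->
  exists C : {set T}, [/\ C \subset B, {in C &, forall x y, ~~ nonedge H x y}
     & #|B| <= #|C|.*2].
Proof.
move=> no; have [->|[v vB]] := set_0Vmem B.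
  by exists set0; split; rewrite ?cards0 // => x y; rewrite inE.
set F := nonedge H in no *.
have Fs x y : F x y = F y x by apply: nonedge_sym.
pose N := B :&: [set y | F v y]; pose M := B :\: [set y | F v y].
have Ncl : {in N &, forall x y, ~~ F x y}.
  move=> x y; rewrite !inE => /andP[xB vx] /andP[yB vy]; apply/negP => xy.
  have := no _ _ _ xB yB vB; rewrite /odd_triple xy !(Fs _ v) vx vy eqxx andbT.
  by have /andP[+ _] := vx; have /andP[+ _] := vy; rewrite ![v == _]eq_sym => -> ->.
have Mcl : {in M &, forall x y, ~~ F x y}.
  move=> x y; rewrite !inE => /andP[vx xB] /andP[vy yB]; apply/negP => xy.
  have := no _ _ _ xB yB vB; rewrite /odd_triple xy !(Fs _ v) (negPf vx) (negPf vy) /=.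
  rewrite eqxx andbT; case: (eqVneq x v) => [xv|_]; first by rewrite -xv xy in vy.
  by case: (eqVneq y v) => [yv|//]; rewrite -yv Fs xy in vx.
have := cardsID [set y | F v y] B; rewrite -/N -/M => BE.
case: (leqP #|M| #|N|) => NM.
  exists N; split; rewrite ?subsetIl //.
  by rewrite -BE -addnn leq_add2l.
exists M; split; rewrite ?subsetDl //.
by rewrite -BE -addnn leq_add2r ltnW.
Qed.

(** The target for a union [A] of [m] mutually joined classes is
    [#|A| + m <= 3 * size Q + 1]. Two such bounds do not add up, so the
    slack of one is recorded together with a member of size three, from which
    [surplus_join] regains it. *)
Definition surplus (T : finType) (H : hypergraph T) (A : {set T}) (m : nat) : Prop :=
  (exists2 Q, clique_seq H A Q & #|A| + m <= 3 * size Q) \/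
  (exists S Q, [/\ clique_seq H A (S :: Q), #|S| = 3 & #|A| + m <= 3 * size (S :: Q) + 1]).

(** Odd triples are removed greedily: each has three vertices and links to
    everything else. What remains is covered by two cliques, the larger of which
    contributes a singleton per vertex. If a triple has been removed, it is
    the member required by the second case of [surplus]; otherwise,
    three times the larger clique exceeds a nonempty [B]. *)
Lemma class_surplus (T : finType) (H : hypergraph T) (B : {set T}) :
  alpha H <= 2 -> B \subset verts H ->
  (exists2 Q, clique_seq H B Q & #|B| <= 3 * size Q) /\ (B != set0 -> surplus H B 1).
Proof.
move=> a2; have [n] := ubnP #|B|; elim: n B => // n IH B; rewrite ltnS => le_n BV.
case: (boolP [exists x in B, exists y in B, exists z in B, odd_triple (nonedge H) x y z]).
  case/exists_inP=> x xB /exists_inP[y yB] /exists_inP[z zB] /and4P[xz yz Nxy /eqP Nz].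
  pose S := [set x; y; z].
  have SB : S \subset B by apply/subsetP => u; rewrite !inE => /orP[/orP[]|]/eqP->.
  have xy : x != y by case/andP: Nxy.
  have S3 : #|S| = 3 by apply: cards3.
  have [xS yS] : x \in S /\ y \in S by rewrite !inE !eqxx orbT.
  have BD : #|B| = 3 + #|B :\: S| by rewrite -(cardsID S B) (setIidPr SB) S3.
  have DV : B :\: S \subset verts H by apply: subset_trans (subsetDl _ _) BV.
  have [|[Q Qc Qs] _] := IH (B :\: S) _ DV.
    by apply: leq_trans _ le_n; rewrite BD -[X in X < _]add0n ltn_add2r.
  have SQ : clique_seq H B (S :: Q).
    apply: clique_seq_cons (clique_seq_sub (subsetDl _ _) Qc) => //.
    - by apply/set0Pn; exists x.
    - by apply: odd_triple_connected => //; apply: (subsetP BV).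
    case: Qc => Q1 _ _ S' /Q1[S'0 S'D].
    apply: (@nonedge_dominates _ _ _ _ x y) => //.
    - exact: subset_trans BV.
    - exact: subset_trans DV.
    - by rewrite disjoint_sym disjoints_subset (subset_trans S'D) // setDE subsetIr.
  have le : #|B| <= 3 * size (S :: Q) by rewrite BD /= mulnS leq_add2l.
  split; first by exists (S :: Q).
  by move=> _; right; exists S, Q; split=> //; rewrite leq_add2r.
move=> no.
have [|C [CB Ccl BC]] := @two_cliques _ H B.
  move=> x y z xB yB zB; apply: contra no => xyz.
  by apply/exists_inP; exists x => //; apply/exists_inP; exists y => //;
    apply/exists_inP; exists z.
have Qc := clique_seq_sub CB (clique_seq_singletons Ccl).
have sz : size [seq [set x] | x <- enum C] = #|C| by rewrite size_map -cardE.
split.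
  by exists [seq [set x] | x <- enum C]; rewrite // sz; lia.
rewrite -card_gt0 => B0; left; exists [seq [set x] | x <- enum C]; rewrite // sz; lia.
Qed.

(** A pair crossing between [A] and [B] reaches every vertex of [A] through its
    vertex in [B]. *)
Lemma cross_pair_touching (T : finType) (H : hypergraph T) (A B S : {set T}) Q x y :
  joined H A B -> clique_seq H A (S :: Q) -> x \in S -> y \in B ->
  {in Q, forall S', touching H [set x; y] S'}.
Proof.
move=> AB /clique_seq_behead[S0 SA SQ [Q1 _ _]] xS yB S' S'Q.
have [/set0Pn[z zS'] S'A] := Q1 _ S'Q.
have /andP[dis _] := SQ _ S'Q.
apply/andP; split.
  rewrite disjoints_subset subUset !sub1set !inE (disjointFr dis xS) /=.
  apply/negP => /(subsetP S'A); rewrite (disjointFl (joined_disjoint AB)) //.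
rewrite linkedC; apply: (@linked_edge _ _ _ _ z y) => //; last by rewrite !inE eqxx orbT.
by apply: AB => //; apply: (subsetP S'A).
Qed.

Lemma cross_pairs_touching (T : finType) (H : hypergraph T) (A B : {set T}) x y x' y' :
  joined H A B -> x \in A -> x' \in A -> y \in B -> y' \in B ->
  x != x' -> y != y' -> touching H [set x; y] [set x'; y'].
Proof.
move=> AB xA x'A yB y'B xx' yy'.
have neq u v : u \in A -> v \in B -> u != v by move=> uA vB; apply: edge_neq (AB _ _ uA vB).
apply/andP; split.
  rewrite disjoints_subset subUset !sub1set !inE (negPf xx') (negPf yy') /= orbF.
  by rewrite (neq x) // eq_sym (neq x').
apply: (@linked_edge _ _ _ _ x y'); rewrite ?inE ?eqxx ?orbT //; exact: AB.
Qed.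

(** The only lossy case is that both sides carry the slack of one. Then the two
    triples are replaced by three pairs, each crossing from one triple to the
    other: the pairs link to everything, and the additional member pays for the
    combined slack. *)
Lemma surplus_join (T : finType) (H : hypergraph T) (A B : {set T}) m n :
  joined H A B -> surplus H A m -> surplus H B n -> surplus H (A :|: B) (m + n).
Proof.
move=> AB; have le_card : #|A :|: B| <= #|A| + #|B| by rewrite leq_card_setU.
case=> [[Q Qc Qs]|[S [Q [Qc S3 Qs]]]]; case=> [[R Rc Rs]|[S' [R [Rc S'3 Rs]]]].
- left; exists (Q ++ R); first exact: clique_seq_cat.
  rewrite size_cat; move: le_card; lia.
- right; exists S', (R ++ Q); split=> //; last by rewrite /= size_cat; move: le_card Rs => /=; lia.
  by rewrite setUC -cat_cons; apply: clique_seq_cat => //; apply: joinedC.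
- right; exists S, (Q ++ R); split=> //; last by rewrite /= size_cat; move: le_card Qs => /=; lia.
  by rewrite -cat_cons; apply: clique_seq_cat.
have /card_gt2P[x1 [x2 [x3 [[x1S x2S x3S] [x12 x23 x31]]]]] : 2 < #|S| by rewrite S3.
have /card_gt2P[y1 [y2 [y3 [[y1S y2S y3S] [y12 y23 y31]]]]] : 2 < #|S'| by rewrite S'3.
have [S0 SA _ Q'c] := clique_seq_behead Qc.
have [S'0 S'B _ R'c] := clique_seq_behead Rc.
have QRc := clique_seq_cat AB Q'c R'c.
have pairQR x y : x \in S -> y \in S' -> {in Q ++ R, forall X, touching H [set x; y] X}.
  move=> xS yS' X; rewrite mem_cat => /orP[XQ|XR].
    by apply: (cross_pair_touching AB Qc xS) => //; apply: (subsetP S'B).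
  rewrite setUC; apply: (cross_pair_touching (joinedC AB) Rc yS') => //.
  exact: (subsetP SA).
have pairs x y x' y' : x \in S -> x' \in S -> y \in S' -> y' \in S' ->
    x != x' -> y != y' -> touching H [set x; y] [set x'; y'].
  by move=> xS x'S yS y'S; apply: (cross_pairs_touching AB);
    rewrite ?(subsetP SA) ?(subsetP S'B).
have add x y L : x \in S -> y \in S' -> {in L, forall X, touching H [set x; y] X} ->
    clique_seq H (A :|: B) L -> clique_seq H (A :|: B) ([set x; y] :: L).
  move=> xS yS; have [xA yB] := (subsetP SA _ xS, subsetP S'B _ yS).
  apply: clique_seq_cons.
  - by apply/set0Pn; exists x; rewrite !inE eqxx.
  - by rewrite subUset !sub1set !inE xA yB orbT.
  - by apply: hedge_connected; apply: AB.
left; exists [:: [set x1; y1], [set x2; y2], [set x3; y3] & Q ++ R]; last first.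
  move: le_card Qs Rs; rewrite /= size_cat.
  by move: #|A| #|B| #|A :|: B| (size Q) (size R); clear; lia.
apply: (add) => //; last apply: (add) => //; last apply: (add) => //.
- move=> X; rewrite !inE => /or3P[/eqP->|/eqP->|XQR]; last exact: pairQR XQR.
    exact: pairs.
  by apply: pairs => //; rewrite eq_sym.
- move=> X; rewrite inE => /orP[/eqP->|XQR]; last exact: pairQR XQR.
  exact: pairs.
- exact: pairQR.
Qed.

Lemma classes_surplus (T : finType) (H : hypergraph T) (P : seq {set T}) :
  alpha H <= 2 ->
  {in P, forall B : {set T}, B != set0 /\ B \subset verts H} ->
  pairwise (fun A B : {set T} => [forall x in A, forall y in B, [set x; y] \in hedges H]) P ->
  surplus H (\bigcup_(B <- P) B) (size P).
Proof.
move=> a2; elim: P => [|B P IH] Pin Ppair.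
  by left; exists [::]; rewrite // big_nil cards0.
move: Ppair; rewrite pairwise_cons => /andP[/allP BP Ppair].
rewrite big_cons /= -add1n; apply: surplus_join.
- move=> x y xB; rewrite bigcup_seq => /bigcupP[C CP yC].
  by have /forall_inP/(_ x xB)/forall_inP/(_ y yC) := BP _ CP.
- have [B0 BV] := Pin B (mem_head _ _).
  by have [_] := class_surplus a2 BV; apply.
- by apply: IH => // C CP; apply: Pin; rewrite inE CP orbT.
Qed.

(** * The chromatic number and the theorem *)

Lemma matching_colorable (T : finType) (H : hypergraph T) (f : {ffun T -> T}) :
  matching (nonedge H) (verts H) f -> colorable H #|leaders (verts H) f|.
Proof.
move=> fM; have [fK fF] := matchingP _ _ _ fM.
set R := leaders _ _.
pose r x := if enum_rank x <= enum_rank (f x) then x else f x.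
have rR (x : {x : T | x \in verts H}) : r (val x) \in R.
  rewrite /r inE; case: ifPn => [->|]; first by rewrite (valP x).
  rewrite -ltnNge fK => /ltnW ->; rewrite andbT.
  exact: matching_in fM (valP x).
pose s (x : {x : T | x \in verts H}) : {x | x \in R} := exist (fun x => x \in R) _ (rR x).
have cardR : #|{: {x | x \in R}}| = #|R| by rewrite card_sig.
apply/existsP; exists [ffun x => cast_ord cardR (enum_rank (s x))].
apply/forallP => i; apply/andP; split.
  by apply/subsetP => _ /imsetP[x _ ->]; apply: (valP x).
apply/forall_inP => e eH; apply/negP => /subsetP ei.
have re x y : x \in e -> y \in e -> r x = r y.
  move=> /ei/imsetP[x' + ->] /ei/imsetP[y' + ->].
  rewrite !inE !ffunE => /eqP xi /eqP yi.
  have : s x' = s y' by apply: enum_rank_inj; apply: (@cast_ord_inj _ _ cardR); rewrite xi.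
  by move/(congr1 val).
have /card_gt1P[x [y [xe ye xy]]] := hedge_card eH.
have rP u v : r u = r v -> v = u \/ v = f u.
  rewrite /r; do 2!case: ifP => _; move=> E; [left|right|right|left].
  - by [].
  - by rewrite E fK.
  - by [].
  - by rewrite -[v]fK -E fK.
have yf : y = f x by case: (rP _ _ (re _ _ xe ye)) => // E; rewrite E eqxx in xy.
have [_ /andP[_ /negP]] := fF x (ltac:(by rewrite -yf eq_sym)); case.
suff <- : e = [set x; f x] by [].
apply/eqP; rewrite eqEsubset subUset !sub1set xe -yf ye !andbT.
by apply/subsetP => z ze; rewrite !inE yf; case: (rP _ _ (re _ _ xe ze)) => ->; rewrite eqxx ?orbT.
Qed.

Lemma chi_needs (T : finType) (H : hypergraph T) : needs (nonedge H) (chi H) (verts H).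
Proof.
apply/forallP => f; apply/implyP => fM; rewrite (card_leaders fM) leq_double.
rewrite /chi; case: ex_minnP => k _; apply; exact: matching_colorable.
Qed.

Lemma chi_clique_seq (T : finType) (H : hypergraph T) :
  alpha H <= 2 ->
  exists2 Q, clique_seq H (verts H) Q & (chi H).*2 <= 3 * size Q + 1.
Proof.
move=> a2; have [A Amin AV] := minset_exists (chi_needs H).
have [P [Ppart Psep le_P]] := gallai_partition (@nonedge_sym _ H)
  (minsetp Amin) (minimal_needs Amin).
have /and3P[/eqP cov _ P0] := Ppart.
have PA B : B \in P -> B \subset A by move=> BP; rewrite -cov; apply: bigcup_sup.
have : surplus H (\bigcup_(B <- enum P) B) (size (enum P)).
  apply: classes_surplus => // [B|].
    rewrite mem_enum => BP; split; last exact: subset_trans (PA _ BP) AV.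
    by apply: contraNneq P0 => <-.
  have := enum_uniq P; rewrite uniq_pairwise.
  apply: sub_in_pairwise (allss _) => B C; rewrite -!topredE /= !mem_enum => BP CP BC.
  apply/forall_inP => x xB; apply/forall_inP => y yC.
  have := Psep _ _ _ _ BP CP BC xB yC; rewrite /nonedge negb_and !negbK.
  case/orP=> // /eqP xy; have /and3P[_ /trivIsetP triv _] := Ppart.
  by have := disjointFr (triv _ _ BP CP BC) xB; rewrite xy yC.
have -> : \bigcup_(B <- enum P) B = A by rewrite -cov /cover big_enum.
rewrite -cardE; case=> [[Q Qc Qs]|[S [Q [Qc _ Qs]]]].
  exists Q; first exact: clique_seq_sub Qc.
  by move: le_P Qs; lia.
exists (S :: Q); first exact: clique_seq_sub Qc.
exact: leq_trans Qs.
Qed.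

Import Order.TTheory GRing.Theory Num.Theory.
Local Open Scope ring_scope.

Theorem theorem3 (t : nat) (ht : (2 <= t)%N) (T : finType) (H : hypergraph T)
    (halpha : (alpha H <= 2)%N) (hminor : ~ minor (complete_graph t) H) :
  (chi H)%:Z <= Num.ceil ((3 / 2 : rat) * (t%:R - 1)).
Proof.
have [Q Qc Qs] := chi_clique_seq halpha.
have ltQ : (size Q < t)%N.
  by rewrite ltnNge; apply/negP => /(clique_seq_minor Qc).
have le_chi : ((chi H).*2 + 2 <= 3 * t)%N by lia.
have : ((chi H).*2 + 2)%:R <= (3 * t)%:R :> rat by rewrite ler_nat.
rewrite -muln2 natrD !natrM => le_rat.
have : (chi H)%:Z - 1 < Num.ceil ((3 / 2 : rat) * (t%:R - 1)); last by lia.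
rewrite ceil_gt_int rmorphB /= -pmulrn; lra.
Qed.
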